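(* Let $m$, $k$, and $n$ be integers. Then $$\sum_{i = 1}^\infty \frac{q^{m(i - k)}}{w_{m(i - k) + n}\, w_{m(i + k) + n}} = \frac{1}{e_w u_n u_{2km}} \left( \sum_{i = 1}^{2k} \frac{w_{m(i - k)}}{w_{m(i - k) + n}} - \frac{2k}{\alpha^n} \right),$$ and especially with $n=mk$, $$\sum_{i = 1}^\infty \frac{q^{m(i - k)}}{w_{mi}\, w_{m(i + 2k)}} = \frac{1}{e_w u_{mk} u_{2km}} \left(\sum_{i = 1}^{2k} \frac{w_{m(i - k)}}{w_{mi}} - \frac{2k}{\alpha^{mk}} \right).$$
   Context: Let $a,b,p,q$ be complex numbers with $q\neq 0$. The Horadam sequence $(w_n)_{n\in\mathbb{Z}}=(w_n(a,b;p,q))_{n\in\mathbb{Z}}$ is defined by $w_0=a$, $w_1=b$, $w_n=pw_{n-1}-qw_{n-2}$, extended by the same recurrence to all integer indices. Put $u_n=w_n(0,1;p,q)$. Let $\alpha,\beta$ be the roots of $x^2-px+q=0$; they are assumed distinct, i.e. $\Delta=p^2-4q\neq 0$, with $|\alpha|>|\beta|$. For all $n\in\mathbb{Z}$, $w_n=\frac{A\alpha^n-B\beta^n}{\alpha-\beta}$ with $A=b-a\beta$, $B=b-a\alpha$, and $u_n=\frac{\alpha^n-\beta^n}{\alpha-\beta}$. Put $e_w=-AB=pab-qa^2-b^2$. All quantities occurring in denominators are understood to be nonzero. Infinite series denote limits of partial sums. Summation convention for an integer upper limit $M\le 0$: $\sum_{i=1}^{0}g(i)=0$ and $\sum_{i=1}^{M}g(i)=-\sum_{i=M+1}^{0}g(i)$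 for $M<0$.
   Formalization: The formal statement assumes m > 0: m = 0 makes u_{2km} zero, and for m < 0 the printed formulas are always false, since the limit is β^{-n}, not α^{-n} (e.g. p=3, q=2, a=2, b=3, m=-1, k=n=1: positive series, right side -5/9). *)

(* Defs.v *)
From HB Require Import structures.
From mathcomp Require Import all_boot all_order all_algebra.
From mathcomp Require Import all_classical all_reals all_analysis.
From mathcomp Require Import complex.
From mathcomp Require Import ring zify.

Set Implicit Arguments.
Unset Strict Implicit.
Unset Printing Implicit Defensive.

Import Order.TTheory GRing.Theory Num.Theory.
Import numFieldNormedType.Exports.
Local Open Scope ring_scope.
Local Open Scope classical_set_scope.

(* g 1 + g 2 + ... converges, with sum l. For K = R[i] the topology is that
   of the norm `|z| on the numFieldType R[i], i.e., the complex modulus. *)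
Definition series1_cvg (K : numFieldType) (g : nat -> K) (l : K) : Prop :=
  (fun N : nat => \sum_(1 <= i < N.+1) g i) @ \oo --> l.

Section Horadam.
Variable F : fieldType.
Implicit Types a b p q : F.

Fixpoint horadam_nat a b p q (n : nat) : F :=
  match n with
  | 0 => a
  | 1 => b
  | (n'.+1 as n1).+1 =>
      p * horadam_nat a b p q n1 - q * horadam_nat a b p q n'
  end.

(* For n >= 0, v_n = w_(-n) is the Horadam sequence with
   v_0 = a, v_1 = (p a - b) / q and v_n = (p / q) v_(n-1) - q^-1 v_(n-2):
   this is the given recurrence run backwards. Recall Negz n = - n.+1. *)
Definition horadam a b p q (n : int) : F :=
  match n with
  | Posz n => horadam_nat a b p q n
  | Negz n => horadam_nat a ((p * a - b) / q) (p / q) q^-1 n.+1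
  end.

Definition lucasU p q (n : int) : F := horadam 0 1 p q n.

Definition horadam_e a b p q : F := p * a * b - q * a ^+ 2 - b ^+ 2.

(* Sum of g i for i from 1 to M, for an integer M; when M < 0 it is
   - (g (M + 1) + ... + g 0). *)
Definition sumz (M : int) (g : int -> F) : F :=
  match M with
  | Posz N => \sum_(1 <= i < N.+1) g i%:Z
  | Negz N => - \sum_(0 <= i < N.+1) g (- i%:Z)
  end.

Lemma horadam_rec a b p q (n : int) : q != 0 ->
  horadam a b p q (n + 2) =
  p * horadam a b p q (n + 1) - q * horadam a b p q n.
Proof.
move=> q0; case: n => [n|[|[|n]]].
- by rewrite -!PoszD addn2 addn1.
- by rewrite /=; field.
- by rewrite /=; field.
- have -> : Negz n.+2 + 2 = Negz n by lia.
  have -> : Negz n.+2 + 1 = Negz n.+1 by lia.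
  rewrite /horadam; set v := horadam_nat _ _ _ _.
  have -> : v n.+3 = p / q * v n.+2 - q^-1 * v n.+1 by [].
  by field.
Qed.

End Horadam.

(* Main.v *)
(* Binet's formula gives
     w_s w_(t+n) - w_t w_(s+n) = e_w q^s u_n u_(t-s),
   so, with f j = w_(mj) / w_(mj+n), the i-th term of the series is
   (f (i-k) - f (i+k)) / (e_w u_n u_(2km)). The sum from 1 to N of the
   numerators is the difference between the 2k-term window sums of f that
   start at 1 - k and at N + 1 - k, and f j tends to alpha^-n as j -> oo since
   e_w != 0 forces b - a beta != 0. *)
Require Import Defs.
From mathcomp Require Import all_boot all_order all_algebra.
From mathcomp Require Import all_classical all_reals all_analysis.
From mathcomp Require Import complex.
From mathcomp Require Import ring zify.
Import Order.TTheory GRing.Theory Num.Theory.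
Import numFieldNormedType.Exports.
Local Open Scope classical_set_scope.
Local Open Scope ring_scope.

(** Two-step induction: both sides obey the recurrence whose characteristic roots are x and y.
    Keeping the factor x - y on the left avoids a division. *)
Lemma horadam_nat_binet (F : fieldType) (a b x y : F) (n : nat) :
  horadam_nat a b (x + y) (x * y) n * (x - y) =
  (b - a * y) * x ^+ n - (b - a * x) * y ^+ n.
Proof.
elim/ltn_ind: n => -[|[|n]] IH.
- by rewrite /= !expr0; ring.
- by rewrite /= !expr1; ring.
- have -> : horadam_nat a b (x + y) (x * y) n.+2 =
      (x + y) * horadam_nat a b (x + y) (x * y) n.+1
      - x * y * horadam_nat a b (x + y) (x * y) n by [].
  by rewrite mulrBl -!mulrA !IH// !exprS; ring.
Qed.

Lemma horadam_binet (F : fieldType) (a b x y : F) (n : int) :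
  x != 0 -> y != 0 ->
  horadam a b (x + y) (x * y) n * (x - y) =
  (b - a * y) * x ^ n - (b - a * x) * y ^ n.
Proof.
move=> x0 y0; case: n => n; first exact: horadam_nat_binet.
rewrite /horadam !NegzE -!exprnN.
(* The backward sequence has coefficients p / q and q^-1, the sum and product of x^-1 and y^-1, so
   the case of natural indices applies to the inverse roots. *)
have -> : (x + y) / (x * y) = x^-1 + y^-1 by field; rewrite ?x0 ?y0.
rewrite invfM -[x^-1 * y^-1]/(x^-1 / y).
set b' := (X in horadam_nat a X).
have -> : x - y = - (x * y) * (x^-1 - y^-1) by field; rewrite ?x0 ?y0.
rewrite mulrCA horadam_nat_binet -!exprVn /b'.
by field; rewrite ?x0 ?y0.
Qed.

Lemma horadam_cross (F : fieldType) (a b x y : F) (s t n : int)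
  (w := horadam a b (x + y) (x * y)) (u := lucasU (x + y) (x * y)) :
  x != 0 -> y != 0 -> x != y ->
  w s * w (t + n) - w t * w (s + n) =
  horadam_e a b (x + y) (x * y) * u n * u (t - s) * (x * y) ^ s.
Proof.
move=> x0 y0 xy; have d0 : x - y != 0 by rewrite subr_eq0.
have wE j : w j = ((b - a * y) * x ^ j - (b - a * x) * y ^ j) / (x - y).
  by rewrite -horadam_binet// mulfK.
have uE j : u j = (x ^ j - y ^ j) / (x - y).
  have /(canRL (mulfK d0)) := @horadam_binet F 0 1 x y j x0 y0.
  by rewrite !mul0r !subr0 !mul1r.
rewrite !wE !uE /horadam_e !(expfzDr _ _ x0) !(expfzDr _ _ y0).
rewrite -!invr_expz expfzMl.
have := expfz_neq0 s x0; have := expfz_neq0 s y0.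
(* The six powers may be treated as independent variables; x ^ s and y ^ s must stay nonzero because
   t - s puts them in denominators. *)
move: (x ^ s) (y ^ s) (x ^ t) (y ^ t) (x ^ n) (y ^ n) => xs ys xt yt xn yn.
by move=> ys0 xs0; field; rewrite d0 xs0 ys0.
Qed.

(** Both branches telescope. The convention for M < 0 is what preserves the identity there, so that
    k of either sign can be treated at once. *)
Lemma sumz_shift (F : fieldType) (M : int) (g : int -> F) :
  sumz M (fun i => g (i + 1)) - sumz M g = g (M + 1) - g 1.
Proof.
case: M => N /=.
- rewrite -sumrB -[N.+1]addn1 -{1}[1%N]add0n big_addn addnK.
  rewrite (eq_bigr (fun i => g i.+2%:Z - g i.+1%:Z)).
    rewrite (@telescope_sumr _ 0 N (fun i => g i.+1%:Z))//.
    by rewrite -PoszD addn1.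
  by move=> i _; rewrite -!PoszD !addn1.
- rewrite -opprD -sumrB.
  rewrite (eq_bigr (fun i => - (g (1 - i.+1%:Z) - g (1 - i%:Z)))).
    rewrite sumrN (@telescope_sumr _ 0 N.+1 (fun i => g (1 - i%:Z)))//.
    by rewrite opprK; congr (g _ - g _); lia.
  move=> i _; rewrite opprB; congr (g _ - g _); lia.
Qed.

Lemma cvg_sumz (K : numFieldType) (M : int) (g : nat -> int -> K) (l : K) :
  (forall i, (fun N => g N i) @ \oo --> l) ->
  (fun N => sumz M (g N)) @ \oo --> M%:~R * l.
Proof.
move=> gl; case: M => M /=.
- have -> : M%:~R * l = \sum_(1 <= i < M.+1) l.
    by rewrite sumr_const_nat subn1 mulr_natl.
  by apply: cvg_big => //; exact: add_continuous.
- have -> : (Negz M)%:~R * l = - \sum_(0 <= i < M.+1) l.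
    by rewrite sumr_const_nat subn0 NegzE mulrNz mulNr mulr_natl.
  by apply: cvgN; apply: cvg_big => //; exact: add_continuous.
Qed.

Lemma series1_cvg_telescope (K : numFieldType) (f : int -> K) (k : int)
  (l : K) :
  (forall c : int, (fun N : nat => f (N%:Z + c)) @ \oo --> l) ->
  series1_cvg (fun i => f (i%:Z - k) - f (i%:Z + k))
    (sumz (2 * k) (fun i => f (i - k)) - (2 * k)%:~R * l).
Proof.
move=> fl; pose S (N : nat) := sumz (2 * k) (fun i => f (N%:Z + (i - k))).
have S0 : S 0%N = sumz (2 * k) (fun i => f (i - k)).
  by congr sumz; apply: funext => i; rewrite add0r.
(* Moving the window one place drops f (N + 1 - k) and gains f (N + 1 + k): the loss is the series
   term of index N + 1. *)
have SS N : S N - S N.+1 = f (N.+1%:Z - k) - f (N.+1%:Z + k).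
  have := @sumz_shift K (2 * k) (fun i => f (N%:Z + (i - k))).
  rewrite -/(S N).
  have -> : (fun i => f (N%:Z + (i + 1 - k))) =
            (fun i => f (N.+1%:Z + (i - k))).
    by apply: funext => i; congr f; lia.
  rewrite -/(S N.+1) => /(congr1 -%R); rewrite !opprB => ->.
  by congr (f _ - f _); lia.
rewrite /series1_cvg -S0.
have -> : (fun N : nat => \sum_(1 <= i < N.+1) (f (i%:Z - k) - f (i%:Z + k)))
          = (fun N => S 0%N - S N).
  apply: funext => N; elim: N => [|N IH]; first by rewrite big_geq// subrr.
  by rewrite big_nat_recr//= IH -SS addrA subrK.
apply: cvgB; first exact: cvg_cst.
exact: cvg_sumz.
Qed.

(** The modulus of z is an embedded real r with 0 <= r < 1, and z ^+ N has modulus r ^+ N, so the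
    real geometric sequence decides. *)
Lemma cvg_expr_complex (R : realType) (z : (R[i] : numFieldType)) :
  `|z| < 1 -> (fun N : nat => z ^+ N) @ \oo --> (0 : (R[i] : numFieldType)).
Proof.
have [r zr] : exists r : R, `|z| = r%:C%C by rewrite normc_def; eexists.
have r0 : 0 <= r by rewrite -lecR -zr normr_ge0.
rewrite zr -[1]/(1%:C%C) ltcR => r1.
have /cvgrPdist_lt rN : (GRing.exp r : R ^nat) @ \oo --> 0.
  by apply: cvg_expr; rewrite ger0_norm.
apply/cvgrPdist_lt => e e0.
(* The order on R[i] only compares numbers with equal imaginary parts, so a positive e is real. *)
have eE : e = (complex.Re e)%:C%C.
  by case: e e0 => e1 e2; rewrite ltcE /= => /andP[/eqP -> _].
have e1 : 0 < complex.Re e by rewrite -ltcR -eE.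
apply: filterS (rN _ e1) => N.
have zN : `|0 - z ^+ N| = (r ^+ N)%:C%C.
  by rewrite sub0r normrN normrX rmorphXn /= -zr.
by rewrite sub0r normrN ger0_norm ?exprn_ge0// -ltcR -eE -zN.
Qed.

Lemma cvg_horadam_ratio (K : numFieldType) (a b x y : K) (m n c : int)
  (w := horadam a b (x + y) (x * y)) :
  x != 0 -> y != 0 -> x != y -> b - a * y != 0 ->
  (fun N : nat => ((y / x) ^ m) ^+ N) @ \oo --> (0 : K) ->
  (fun N : nat => w (m * (N%:Z + c)) / w (m * (N%:Z + c) + n)) @ \oo
    --> (x ^ n)^-1.
Proof.
move=> x0 y0 xy A0 r0; have d0 : x - y != 0 by rewrite subr_eq0.
set A := b - a * y in A0; pose B := b - a * x.
pose C := (y / x) ^ (m * c).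
pose r (N : nat) := C * ((y / x) ^ m) ^+ N.
have rE N : r N = (y / x) ^ (m * (N%:Z + c)).
  by rewrite mulrDr addrC expfzDr ?mulf_neq0 ?invr_neq0// -(exprz_exp _ m N).
(* Binet's formula, with numerator and denominator divided by x ^ s for s = m (N + c). *)
have -> : (fun N : nat => w (m * (N%:Z + c)) / w (m * (N%:Z + c) + n)) =
          (fun N => (A - B * r N) / (A * x ^ n - B * y ^ n * r N)).
  apply: funext => N; rewrite rE; move: (m * _) => s.
  have wE j : w j = (A * x ^ j - B * y ^ j) / (x - y).
    by rewrite -horadam_binet// mulfK.
  rewrite !wE !expfzDr// expfzMl exprz_inv -invr_expz.
  have xs0 := expfz_neq0 s x0.
  (* Only the nonzero factor (x - y)^-1 is cancelled; with 0^-1 = 0 this stays valid at indices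
     where the denominator vanishes. *)
  rewrite -[LHS]mulf_div divff ?invr_neq0// mulr1.
  have -> : A - B * (y ^ s / x ^ s) = (A * x ^ s - B * y ^ s) / x ^ s by field.
  have -> : A * x ^ n - B * y ^ n * (y ^ s / x ^ s) =
            (A * (x ^ s * x ^ n) - B * (y ^ s * y ^ n)) / x ^ s by field.
  by rewrite -[RHS]mulf_div divff ?invr_neq0// mulr1.
have {}r0 : r @ \oo --> (0 : K).
  by rewrite -(mulr0 C); apply: cvgM => //; exact: cvg_cst.
have rl (D E : K) : (fun N => D - E * r N) @ \oo --> D.
  rewrite -[X in _ --> X]subr0 -(mulr0 E).
  by apply: cvgB; [exact: cvg_cst|apply: cvgM => //; exact: cvg_cst].
have xn0 := expfz_neq0 n x0.
have -> : (x ^ n)^-1 = A / (A * x ^ n) by rewrite invfM mulVKf.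
by apply: cvgM => //; apply: cvgV => //; rewrite mulf_neq0.
Qed.

(** The decay of the powers of (beta / alpha) ^ m is the only analytic input, so the argument runs
    over any [numFieldType]. *)
Lemma horadam_series (K : numFieldType) (a b p q alpha beta : K) (m k n : int)
  (w := horadam a b p q) (u := lucasU p q) (ew := horadam_e a b p q) :
  q != 0 ->
  root ('X^2 - p *: 'X + q%:P) alpha ->
  root ('X^2 - p *: 'X + q%:P) beta ->
  alpha != beta ->
  (fun N : nat => ((beta / alpha) ^ m) ^+ N) @ \oo --> (0 : K) ->
  ew != 0 ->
  u (2 * k * m) != 0 ->
  u n != 0 ->
  (forall i : nat, (1 <= i)%N ->
     w (m * (i%:Z - k) + n) != 0 /\ w (m * (i%:Z + k) + n) != 0) ->
  series1_cvg
    (fun i : nat => q ^ (m * (i%:Z - k)) /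
       (w (m * (i%:Z - k) + n) * w (m * (i%:Z + k) + n)))
    (1 / (ew * u n * u (2 * k * m)) *
       (sumz (2 * k) (fun i : int => w (m * (i - k)) / w (m * (i - k) + n))
        - (2 * k)%:~R / alpha ^ n)).
Proof.
move=> q0 /rootP ra /rootP rb; rewrite !hornerE in ra rb.
move=> xy r0 ew0 uk0 un0 w0.
(* Vieta: subtracting the two root equations leaves (alpha - beta) (alpha + beta - p) = 0. *)
have pE : p = alpha + beta.
  have d0 : alpha - beta != 0 by rewrite subr_eq0.
  apply: (mulfI d0); apply/eqP; rewrite -subr_eq0 -(subr0 0) -{1}rb -ra.
  by apply/eqP; ring.
have qE : q = alpha * beta.
  by apply/eqP; rewrite -subr_eq0 -ra pE; apply/eqP; ring.
have [x0 y0] : alpha != 0 /\ beta != 0.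
  by apply/andP; rewrite -negb_or -mulf_eq0 -qE.
have A0 : b - a * beta != 0.
  apply: contraNneq ew0 => A0.
  have -> : ew = - ((b - a * beta) * (b - a * alpha)).
    by rewrite /ew /horadam_e pE qE; ring.
  by rewrite A0 mul0r oppr0.
pose f (j : int) := w (m * j) / w (m * j + n).
have fl (c : int) : (fun N : nat => f (N%:Z + c)) @ \oo --> (alpha ^ n)^-1.
  by rewrite /f /w pE qE; apply: cvg_horadam_ratio.
pose e := 1 / (ew * u n * u (2 * k * m)).
rewrite /series1_cvg.
have -> : (fun N : nat => \sum_(1 <= i < N.+1) q ^ (m * (i%:Z - k)) /
       (w (m * (i%:Z - k) + n) * w (m * (i%:Z + k) + n))) =
    (fun N : nat => e * \sum_(1 <= i < N.+1) (f (i%:Z - k) - f (i%:Z + k))).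
  apply: funext => N; rewrite mulr_sumr; apply: eq_big_nat => i /andP[i1 _].
  have [w1 w2] := w0 i i1.
  have := @horadam_cross _ a b alpha beta (m * (i%:Z - k)) (m * (i%:Z + k)) n
    x0 y0 xy.
  have -> : m * (i%:Z + k) - m * (i%:Z - k) = 2 * k * m by ring.
  rewrite -pE -qE -/w -/u -/ew => cross.
  have e0 : ew * u n * u (2 * k * m) != 0 by rewrite !mulf_neq0.
  (* Inserting e_w u_n u_(2km) and its inverse around the power of q exposes the right side of
     [cross]. *)
  by rewrite -(mulKf e0 (q ^ _)) -cross /e /f; field; rewrite w1 w2 ew0 un0 uk0.
apply: cvgMl_tmp.
exact: (@series1_cvg_telescope _ f).
Qed.

Theorem corollary3 (R : realType) (a b p q alpha beta : R[i]) (m k n : int)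
  (w := horadam a b p q) (u := lucasU p q) (ew := horadam_e a b p q) :
  q != 0 ->
  p ^+ 2 - 4 * q != 0 ->
  root ('X^2 - p *: 'X + q%:P) alpha ->
  root ('X^2 - p *: 'X + q%:P) beta ->
  `|beta| < `|alpha| ->
  0 < m ->
  ew != 0 ->
  u (2 * k * m) != 0 ->
  (u n != 0 ->
   (forall i : nat, (1 <= i)%N ->
      w (m * (i%:Z - k) + n) != 0 /\ w (m * (i%:Z + k) + n) != 0) ->
   series1_cvg
     (fun i : nat => q ^ (m * (i%:Z - k)) /
        (w (m * (i%:Z - k) + n) * w (m * (i%:Z + k) + n)))
     (1 / (ew * u n * u (2 * k * m)) *
        (sumz (2 * k) (fun i : int => w (m * (i - k)) / w (m * (i - k) + n))
         - (2 * k)%:~R / alpha ^ n)))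
  /\
  (u (m * k) != 0 ->
   (forall i : nat, (1 <= i)%N ->
      w (m * i%:Z) != 0 /\ w (m * (i%:Z + 2 * k)) != 0) ->
   series1_cvg
     (fun i : nat => q ^ (m * (i%:Z - k)) /
        (w (m * i%:Z) * w (m * (i%:Z + 2 * k))))
     (1 / (ew * u (m * k) * u (2 * k * m)) *
        (sumz (2 * k) (fun i : int => w (m * (i - k)) / w (m * i))
         - (2 * k)%:~R / alpha ^ (m * k)))).
Proof.
move=> q0 _ ra rb ba m0 ew0 uk0.
have xy : alpha != beta by apply: contraTneq ba => ->; rewrite ltxx.
have r0 : (fun N : nat => ((beta / alpha) ^ m) ^+ N) @ \oo -->
    (0 : (R[i] : numFieldType)).
  (* Since m > 0, the ratio is raised to a positive natural power, which keeps its modulus below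
     1. *)
  apply: cvg_expr_complex; rewrite -(gez0_abs (ltW m0)) -exprnP normrX.
  rewrite exprn_ilt1 ?absz_eq0 ?gt_eqF// normrM normfV.
  by rewrite ltr_pdivrMr ?mul1r// (le_lt_trans _ ba).
split=> [un0 w0|um0 w0].
  exact: (@horadam_series _ a b p q alpha beta m k n).
(* The second formula is the case n = m k of the first; [E1] and [E2] simplify its indices. *)
have E1 (i : int) : m * (i - k) + m * k = m * i by ring.
have E2 (i : int) : m * (i + k) + m * k = m * (i + 2 * k) by ring.
have := @horadam_series _ a b p q alpha beta m k (m * k) q0 ra rb xy r0 ew0
  uk0 um0.
under [X in series1_cvg X]eq_fun do rewrite E1 E2.
under [X in sumz _ X]eq_fun do rewrite E1.
by apply => i i1; rewrite E1 E2; exact: w0.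
Qed.
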